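(* Let $R$ be a commutative ring with identity $1\neq 0$ that is not an integral domain (so that $\Gamma(R)$ has at least one vertex). (i) If $R$ is finite and $\Gamma(R)$ is a regular graph of degree $r$, then $\alpha(\Gamma(R))$ is either $1$ or $r$. (ii) If $R$ is finite and decomposable and $\Gamma(R)$ is Hamiltonian, then $\alpha(\Gamma(R))=|Z^*(R)|/2$. (iii) If $R$ is a finite principal ideal ring which is not decomposable and $\Gamma(R)$ is Hamiltonian, then $\alpha(\Gamma(R))=1$.
   Context: $Z(R)$ denotes the set of zero-divisors of $R$ and $Z^*(R)=Z(R)\setminus\{0\}$. The zero-divisor graph $\Gamma(R)$ is the simple undirected graph with vertex set $Z^*(R)$, two distinct vertices $x,y$ adjacent iff $xy=0$. A ring is decomposable if it is isomorphic to a direct product of two nonzero rings. A graph is Hamiltonian if it has a cycle passing through every vertex exactly once. A graph is regular of degree $r$ if every vertex has exactly $r$ neighbours. $\alpha(G)$ denotes the independence number (maximum size of a set of pairwise non-adjacent vertices). *)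

(* Defs.v *)
From HB Require Import structures.
From mathcomp Require Import all_boot all_order all_algebra.

Set Implicit Arguments.
Unset Strict Implicit.
Unset Printing Implicit Defensive.

Import GRing.Theory.
Local Open Scope ring_scope.

Record sgraph := SGraph {
  vertex :> finType;
  adj : rel vertex;
  adj_sym : symmetric adj;
  adj_irrefl : irreflexive adj
}.

Definition neighbours (G : sgraph) (x : G) : {set G} := [set y | adj x y].

Definition regular (G : sgraph) (r : nat) : Prop :=
  forall x : G, #|neighbours x| = r.

(* No distinctness condition is needed: [adj] is irreflexive. *)
Definition independent (G : sgraph) (A : {set G}) : bool :=
  [forall x in A, forall y in A, ~~ adj x y].

Definition independence_number (G : sgraph) : nat :=
  \max_(A : {set G} | independent A) #|A|.

(* A cycle of a simple graph has at least three vertices; [cycle] alone would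
   also accept the empty sequence and, for an edge xy, the closed walk x, y. *)
Definition hamiltonian (G : sgraph) : Prop :=
  exists c : seq G,
    [/\ (2 < size c)%N, uniq c, cycle (@adj G) c & forall x : G, x \in c].

Section Rings.
Variable R : finComNzRingType.

(* 0 belongs to Z(R), because R is nonzero. *)
Definition zero_divisors : {set R} :=
  [set x | [exists y, (y != 0) && (x * y == 0)]].

Definition zero_divisors_star : {set R} := zero_divisors :\ 0.

Definition zdg_vertex : finType := {x : R | x \in zero_divisors_star}.

Definition zdg_adj : rel zdg_vertex :=
  fun x y => (x != y) && (val x * val y == 0).

Lemma zdg_adj_sym : symmetric zdg_adj.
Proof. by move=> x y; rewrite /zdg_adj eq_sym mulrC. Qed.

Lemma zdg_adj_irrefl : irreflexive zdg_adj.
Proof. by move=> x; rewrite /zdg_adj eqxx. Qed.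

Definition zero_divisor_graph : sgraph := SGraph zdg_adj_sym zdg_adj_irrefl.

(* The library's [idealr_closed] only covers proper ideals. *)
Definition is_ideal (I : {set R}) : Prop :=
  [/\ 0 \in I,
      forall x y, x \in I -> y \in I -> x + y \in I &
      forall a x, x \in I -> a * x \in I].

Definition principal_ideal_ring : Prop :=
  forall I : {set R}, is_ideal I -> exists a : R, I = [set x * a | x : R].

(* An [nzRingType] satisfies 1 != 0, i.e. it is a nonzero ring. *)
Definition decomposable : Prop :=
  exists (R1 R2 : nzRingType) (f : {rmorphism R -> (R1 * R2)%type}),
    bijective f.

End Rings.

(* Main.v *)
(** Let e be an idempotent other than 0 and 1 and f = 1 - e.

    If the graph is regular of degree r, the neighbours of e are the nonzero
    elements of fR, and these are adjacent to every nonzero element of eR; by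
    regularity the latter have no other neighbour, and the graph is K_(r,r).

    If the graph is Hamiltonian, a set of vertices S whose neighbours all lie
    in T satisfies |S| <= |T|, and |S| = |T| forces S and T to cover the graph.
    Take for S the sums u + n of a unit u of eR and a nonunit n of fR, an
    independent set, and T = fR \ {0}. With a units and z nonunits in eR, b
    units and w nonunits in fR, |S| < |T| reads (a - 1) w < b - 1; as
    z, w >= 1 this cannot hold together with its mirror image
    (b - 1) z < a - 1.

    Without such an idempotent, the zero divisors are nilpotent and form an
    ideal m, annihilated by some nonzero element, so a regular graph is
    complete. If moreover m = (t) and the graph is Hamiltonian, take
    S = m \ m^2 and T = ann(t) \ {0}: since |m| = |m^2| |ann(t)|, the bound
    |S| <= |T| gives m^2 = 0, and the graph is complete. *)

Require Import Defs.
From HB Require Import structures.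
From mathcomp Require Import all_boot all_order all_algebra.
From mathcomp Require Import ring zify.

Local Open Scope ring_scope.

Set Implicit Arguments.
Unset Strict Implicit.
Unset Printing Implicit Defensive.

Import GRing.Theory.

(** * Independent sets and Hamiltonian cycles *)

Section Graphs.
Variable G : sgraph.
Implicit Types (x y : G) (A S T : {set G}).

Lemma independentP A :
  reflect {in A &, forall x y, ~~ adj x y} (independent A).
Proof.
apply: (iffP forall_inP) => [h x y xA yA|h x xA]; first exact: (forall_inP (h x xA)).
by apply/forall_inP => y; apply: h.
Qed.

Lemma leq_independence_number A : independent A -> (#|A| <= independence_number G)%N.
Proof. exact: (@leq_bigmax_cond _ _ (fun B : {set G} => #|B|)). Qed.

Lemma complete_independence_number x0 :
  (forall x y, x != y -> adj x y) -> independence_number G = 1%N.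
Proof.
move=> complG; apply/eqP; rewrite eqn_leq; apply/andP; split.
  apply/bigmax_leqP => A /independentP indA; apply/card_le1P => x xA y.
  rewrite inE; apply/idP/eqP => [yA|->//]; apply/eqP.
  by apply: contraT => /complG; rewrite (negPf (indA _ _ yA xA)).
rewrite -(cards1 x0); apply/leq_independence_number/independentP.
by move=> x y /set1P-> /set1P->; rewrite adj_irrefl.
Qed.

Section Hamiltonian.
Hypothesis hamG : hamiltonian G.
Variables S T : {set G}.
Hypothesis nbST : forall x y, x \in S -> adj x y -> y \in T.

(** The successor map along the cycle is injective and sends [S] into [T]. *)
Lemma hamiltonian_leq_card : (#|S| <= #|T|)%N.
Proof.
have [c [_ uc cyc allc]] := hamG.
rewrite -(card_imset _ (can_inj (prev_next uc))); apply/subset_leq_card/subsetP.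
by move=> _ /imsetP[x xS ->]; apply: nbST xS (next_cycle cyc (allc x)).
Qed.

(* Both the successors and the predecessors of S along the cycle fill up T, so
   S :|: T is stable under taking successors. *)
Lemma hamiltonian_cover : (0 < #|S|)%N -> (#|T| <= #|S|)%N -> S :|: T = setT.
Proof.
have [c [_ uc cyc allc]] := hamG.
case/card_gt0P=> x0 x0S leTS.
have next_inj := can_inj (prev_next uc).
have prev_inj := can_inj (next_prev uc).
have nextS : next c @: S = T.
  apply/eqP; rewrite eqEcard card_imset // leTS andbT; apply/subsetP.
  by move=> _ /imsetP[x xS ->]; apply: nbST xS (next_cycle cyc (allc x)).
have prevS : prev c @: S = T.
  apply/eqP; rewrite eqEcard card_imset // leTS andbT; apply/subsetP.
  move=> _ /imsetP[x xS ->]; apply: nbST xS _.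
  by rewrite adj_sym; apply: prev_cycle.
have clST k : iter k (next c) x0 \in S :|: T.
  elim: k => [|k]; first by rewrite inE x0S.
  rewrite iterS !inE => /orP[xS|]; first by rewrite -nextS imset_f ?orbT.
  by rewrite -prevS => /imsetP[y yS ->]; rewrite next_prev ?yS.
apply/setP => x; rewrite in_setT.
have : fconnect (next c) x0 x.
  by rewrite (fconnect_cycle (cycle_next uc)).
by move/iter_findex => <-; apply: clST.
Qed.

End Hamiltonian.

(** The neighbours of [A] lie in its complement, which takes the role of [T]. *)
Lemma hamiltonian_independent A :
  hamiltonian G -> independent A -> (#|A|.*2 <= #|G|)%N.
Proof.
move=> hamG /independentP indA; rewrite -(cardsC A) -addnn leq_add2l.
apply: hamiltonian_leq_card => // x y xA xy; rewrite inE.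
by apply/negP => yA; rewrite (negPf (indA _ _ xA yA)) in xy.
Qed.

(** Equality case of the previous bound: [S] and [T] cover the graph and |T| <= |S|, so the graph
    has at most 2|S| vertices. *)
Lemma hamiltonian_independence_number S T :
    hamiltonian G -> independent S -> (0 < #|S|)%N -> (#|T| <= #|S|)%N ->
    (forall x y, x \in S -> adj x y -> y \in T) ->
  (independence_number G).*2 = #|G|.
Proof.
move=> hamG indS S0 leTS nbST; apply/eqP; rewrite eqn_leq; apply/andP; split.
  rewrite -geq_half_double; apply/bigmax_leqP => A indA.
  by rewrite geq_half_double hamiltonian_independent.
rewrite -cardsT -(hamiltonian_cover hamG nbST S0 leTS).
rewrite (leq_trans (leq_card_setU _ _)) // -addnn.
have := leq_independence_number indS.
by move=> h; rewrite leq_add // (leq_trans leTS).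
Qed.

End Graphs.

(** * Kernel counting and idempotent powers *)

Lemma card_additive_image (U V : finZmodType) (h : U -> V) (A : {set U}) :
    zmod_morphism h ->
    (forall x y, x \in A -> y \in A -> x + y \in A) ->
    (forall x, x \in A -> - x \in A) ->
  #|A| = (#|h @: A| * #|[set x in A | h x == 0%R]|)%N.
Proof.
move=> hB addA oppA; rewrite -sum1_card (partition_big_imset h) /= -sum_nat_const.
apply: eq_bigr => _ /imsetP[a aA ->]; rewrite sum1dep_card.
(* Translation by [- a] carries the fibre over [h a] onto the kernel of [h] in [A]. *)
rewrite -(card_imset _ (addIr (- a))); apply: eq_card => x; rewrite [RHS]inE.
apply/imsetP/andP => [[y]|[xA /eqP hx]].
  rewrite inE => /andP[yA /eqP hy] ->.
  by rewrite addA ?oppA // hB hy subrr.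
by exists (x + a); rewrite ?addrK // inE addA // -(subr_eq0 (h _)) -hB addrK hx eqxx.
Qed.

(** By the pigeonhole principle the powers of [x] are eventually periodic; an exponent that is a
    multiple of the period, past the preperiod, gives an idempotent. *)
Lemma idempotent_exp (R : finNzRingType) (x : R) :
  exists2 n, (0 < n)%N & x ^+ n * x ^+ n = x ^+ n.
Proof.
have [i [j [ltij eqij]]] : exists i j, (i < j)%N /\ x ^+ i = x ^+ j.
  have /injectivePn[i [j neij eqij]] :
      ~~ injectiveb (fun i : 'I_#|R|.+1 => x ^+ i).
    apply/negP => /injectiveP/leq_card; rewrite card_ord.
    by rewrite ltnn.
  have [ltij|ltji|eij] := ltngtP i j; first by exists i, j.
    by exists j, i.
  by case/eqP: neij; apply: val_inj.
set p := (j - i)%N; have p0 : (0 < p)%N by rewrite subn_gt0.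
have per k m : (i <= m)%N -> x ^+ (m + k * p) = x ^+ m.
  move=> leim; elim: k => [|k IH]; first by rewrite addn0.
  rewrite -[RHS]IH (_ : (m + k.+1 * p = j + (m - i + k * p))%N); last first.
    by rewrite mulSn /p; lia.
  rewrite exprD -eqij -exprD; congr (_ ^+ _); lia.
(* The factor [i.+1] puts the exponent past [i] and keeps it positive when [i] is 0. *)
exists (i.+1 * p)%N; first by rewrite muln_gt0.
by rewrite -exprD per // (leq_trans (leqnSn i)) // leq_pmulr.
Qed.

(** * Idempotents and direct product decompositions *)

(* The ring [e R], with unit [e]. *)
Section Corner.
Variables (R : comNzRingType) (e : R).
Definition corner_pred : {pred R} := fun x => e * x == x.

Lemma corner_zmod : zmod_closed corner_pred.
Proof.
split; first by rewrite unfold_in mulr0.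
by move=> x y; rewrite !unfold_in mulrBr => /eqP-> /eqP->.
Qed.
HB.instance Definition _ := GRing.isZmodClosed.Build R corner_pred corner_zmod.

Hypotheses (ee : e * e = e) (e0 : e != 0).
Definition corner := {x : R | x \in corner_pred}.
HB.instance Definition _ := SubChoice.on corner.
HB.instance Definition _ := [SubChoice_isSubZmodule of corner by <:].


Lemma corner_mul_subproof (x y : corner) : val x * val y \in corner_pred.
Proof. by rewrite unfold_in mulrA (eqP (valP x)). Qed.
Definition corner_mul x y : corner :=
  exist (fun x => x \in corner_pred) _ (corner_mul_subproof x y).
Lemma corner_one_subproof : e \in corner_pred.
Proof. by rewrite unfold_in ee. Qed.
Definition corner_one : corner :=
  exist (fun x => x \in corner_pred) _ corner_one_subproof.

Lemma corner_mulA : associative corner_mul.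
Proof. by move=> x y z; apply: val_inj; rewrite /= mulrA. Qed.
Lemma corner_mulC : commutative corner_mul.
Proof. by move=> x y; apply: val_inj; rewrite /= mulrC. Qed.
Lemma corner_mul1 : left_id corner_one corner_mul.
Proof. by move=> x; apply: val_inj; rewrite /= (eqP (valP x)). Qed.
Lemma corner_mulDl : left_distributive corner_mul +%R.
Proof. by move=> x y z; apply: val_inj; rewrite /= mulrDl. Qed.
Lemma corner_one_neq0 : corner_one != 0.
Proof. by rewrite -val_eqE. Qed.

Definition corner_ring : comNzRingType :=
  HB.pack corner (GRing.Zmodule_isComNzRing.Build corner
    corner_mulA corner_mulC corner_mul1 corner_mulDl corner_one_neq0).

Lemma corner_proj_subproof x : e * x \in corner_pred.
Proof. by rewrite unfold_in mulrA ee. Qed.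
Definition corner_proj x : corner_ring :=
  exist (fun x => x \in corner_pred) (e * x) (corner_proj_subproof x).

Lemma corner_proj_additive : zmod_morphism corner_proj.
Proof. by move=> x y; apply: val_inj; rewrite /= mulrBr. Qed.
Lemma corner_proj_monoid : monoid_morphism corner_proj.
Proof.
split; first by apply: val_inj; rewrite /= mulr1.
by move=> x y; apply: val_inj; rewrite /= mulrACA ee.
Qed.

End Corner.

Lemma idempotent_compl (R : nzRingType) (e : R) :
  e * e = e -> (1 - e) * (1 - e) = 1 - e.
Proof. by move=> ee; rewrite mulrBl mul1r mulrBr mulr1 ee subrr subr0. Qed.

(** [R] is the product of its corners at [e] and [1 - e]; adding the two components inverts the
    projections. *)
Lemma decomposable_of_idempotent (R : finComNzRingType) (e : R) :
  e * e = e -> e != 0 -> e != 1 -> decomposable R.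
Proof.
move=> ee e0 e1.
have ff := idempotent_compl ee.
have f0 : 1 - e != 0 by rewrite subr_eq0 eq_sym.
pose h x := (corner_proj ee e0 x, corner_proj ff f0 x).
have hB : zmod_morphism h by move=> x y; rewrite /h !corner_proj_additive.
have hM : monoid_morphism h.
  have [h1 hm] := corner_proj_monoid ee e0.
  have [h1' hm'] := corner_proj_monoid ff f0.
  by split=> [|x y]; rewrite /h ?h1 ?h1' ?hm ?hm'.
pose hh : {rmorphism R -> _} := HB.pack h
  (GRing.isZmodMorphism.Build _ _ h hB) (GRing.isMonoidMorphism.Build _ _ h hM).
exists (corner_ring ee e0), (corner_ring ff f0), hh.
exists (fun u => val (u.1 : corner e) + val (u.2 : corner (1 - e))) => [x|[u v]].
  by rewrite /= -mulrDl addrC subrK mul1r.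
have eu : e * val (u : corner e) = val (u : corner e).
  exact/eqP/(valP (u : corner e)).
have fv : (1 - e) * val (v : corner (1 - e)) = val (v : corner (1 - e)).
  exact/eqP/(valP (v : corner (1 - e))).
have ef : e * (1 - e) = 0 by rewrite mulrBr mulr1 ee subrr.
congr (_, _); apply: val_inj => /=; rewrite mulrDr.
  by rewrite eu -fv mulrA ef mul0r addr0.
by rewrite fv -eu mulrA (mulrC (1 - e)) ef mul0r add0r.
Qed.

Lemma idempotent_of_decomposable (R : finComNzRingType) :
  decomposable R -> exists e : R, [/\ e * e = e, e != 0 & e != 1].
Proof.
move=> [R1 [R2 [h [g hK gK]]]].
have hinj := can_inj hK.
exists (g (1, 0)); split.
- by apply: hinj; rewrite rmorphM !gK; congr (_, _); rewrite /= ?mulr1 ?mulr0.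
- apply/eqP => /(congr1 h); rewrite gK rmorph0 => -[/eqP].
  by rewrite oner_eq0.
- apply/eqP => /(congr1 h); rewrite gK rmorph1 => -[/esym/eqP].
  by rewrite oner_eq0.
Qed.

(** * Zero divisors of a finite ring and their graph *)

Section ZeroDivisors.
Variable R : finComNzRingType.
Implicit Types (x y e : R) (S T : {set R}).
Local Notation Z := (zero_divisors R).
Local Notation Zs := (zero_divisors_star R).

Lemma zero_divisorsP x : reflect (exists2 y, y != 0 & x * y = 0) (x \in Z).
Proof.
rewrite inE; apply: (iffP existsP) => [[y /andP[y0 /eqP xy]]|[y y0 xy]].
  by exists y.
by exists y; rewrite y0 xy eqxx.
Qed.

Lemma zero_divisors_starI x y : x != 0 -> y != 0 -> x * y = 0 -> x \in Zs.
Proof.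
by move=> x0 y0 xy; rewrite !inE x0; apply/existsP; exists y; rewrite y0 xy eqxx.
Qed.

(** Multiplication by a non-zero-divisor is injective, hence surjective by finiteness. *)
Lemma zero_divisorsPn x : reflect (exists y, x * y = 1) (x \notin Z).
Proof.
apply: (iffP idP) => [xZ|[y xy]]; last first.
  apply/zero_divisorsP => -[z /eqP z0 xz]; apply: z0.
  by rewrite -(mul1r z) -xy mulrAC xz mul0r.
have inj_x : injective ( *%R x).
  move=> y z /eqP; rewrite -subr_eq0 -mulrBr => /eqP xyz; apply/eqP.
  rewrite -subr_eq0; apply: contraNT xZ => yz; apply/zero_divisorsP.
  by exists (y - z).
by have [g _ gK] := injF_bij inj_x; exists (g 1); rewrite gK.
Qed.

Lemma zero_divisorsMl a x : x \in Z -> a * x \in Z.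
Proof.
case/zero_divisorsP => y y0 xy; apply/zero_divisorsP.
by exists y; rewrite // -mulrA xy mulr0.
Qed.

Lemma card_zdg : #|zero_divisor_graph R| = #|Zs|.
Proof. exact: card_sig. Qed.

(** Elements of [S] that are not vertices drop out, so in general cardinals are only bounded. *)
Definition zdg_lift S : {set zero_divisor_graph R} :=
  [set v : zdg_vertex R | val v \in S].

Lemma zdg_vertexP (v : zero_divisor_graph R) : val v \in Zs.
Proof. exact: (valP v). Qed.

Lemma card_zdg_lift_le S : (#|zdg_lift S| <= #|S|)%N.
Proof.
rewrite -(card_imset _ val_inj); apply/subset_leq_card/subsetP.
by move=> _ /imsetP[v /[!inE] vS ->].
Qed.

Lemma card_zdg_lift S : S \subset Zs -> #|zdg_lift S| = #|S|.
Proof.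
move=> sSZ; rewrite -(card_imset _ val_inj); apply: eq_card => x.
apply/imsetP/idP => [[v /[!inE] vS ->] //|xS].
by exists (Sub x (subsetP sSZ x xS)); rewrite ?inE.
Qed.

(** Here and in the next lemma, the graph bounds are restated for ring elements, with zero products
    in place of adjacency. *)
Lemma zdg_hamiltonian_leq_card S T :
    hamiltonian (zero_divisor_graph R) -> S \subset Zs ->
    (forall x y, x \in S -> y \in Zs -> x * y = 0 -> y \in T) ->
  (#|S| <= #|T|)%N.
Proof.
move=> hamG sSZ annST; rewrite -(card_zdg_lift sSZ).
apply: leq_trans (card_zdg_lift_le T); apply: hamiltonian_leq_card => // x y.
rewrite !inE => xS /andP[_ /eqP xy].
exact: annST xS (zdg_vertexP y) xy.
Qed.

Lemma zdg_hamiltonian_independence_number S T :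
    hamiltonian (zero_divisor_graph R) -> S \subset Zs ->
    {in S &, forall x y, x * y != 0} -> (0 < #|S|)%N -> (#|T| <= #|S|)%N ->
    (forall x y, x \in S -> y \in Zs -> x * y = 0 -> y \in T) ->
  (independence_number (zero_divisor_graph R)).*2 = #|Zs|.
Proof.
move=> hamG sSZ indS S0 leTS annST; rewrite -card_zdg.
apply: (@hamiltonian_independence_number _ (zdg_lift S) (zdg_lift T)) => //.
- apply/independentP => x y /[!inE] xS yS.
  by rewrite /= /zdg_adj negb_and indS ?orbT.
- by rewrite card_zdg_lift.
- by rewrite (card_zdg_lift sSZ) (leq_trans (card_zdg_lift_le T)).
- move=> x y; rewrite !inE => xS /andP[_ /eqP xy].
  exact: annST xS (zdg_vertexP y) xy.
Qed.

Lemma zdg_complete_independence_number :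
    Zs != set0 -> {in Zs &, forall x y, x != y -> x * y = 0} ->
  independence_number (zero_divisor_graph R) = 1%N.
Proof.
case/set0Pn=> x0 x0Z complZ.
pose v0 : zero_divisor_graph R := exist (fun x => x \in Zs) x0 x0Z.
apply: (complete_independence_number v0) => x y neq.
by rewrite /= /zdg_adj neq complZ ?eqxx ?zdg_vertexP.
Qed.

(** * Rings with only trivial idempotents *)

Section Local.
Hypothesis trivial_idempotent : forall e, e * e = e -> e = 0 \/ e = 1.

(** Some positive power of [x] is idempotent, and it cannot be 1 since [x] is not a unit. *)
Lemma zero_divisor_nilpotent x : x \in Z -> exists n, x ^+ n = 0.
Proof.
move=> xZ; have [n n0 /trivial_idempotent[]] := idempotent_exp x.
  by exists n.
case: n n0 => // n _; rewrite exprS => xV.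
by case/zero_divisorsPn: xZ; exists (x ^+ n).
Qed.

(** If [u] inverts [x + y], then [u * x] fixes any [w] killed by [u * y]; but [u * x] is nilpotent,
    so [w] cannot be nonzero. *)
Lemma zero_divisorsD x y : x \in Z -> y \in Z -> x + y \in Z.
Proof.
move=> xZ yZ; apply: contraT => /zero_divisorsPn[u xyu].
have [n aN] := zero_divisor_nilpotent (zero_divisorsMl u xZ).
have /zero_divisorsP[w w0 bw] := zero_divisorsMl u yZ.
have aw : u * x * w = w.
  by rewrite -[RHS]mul1r -xyu -[LHS]addr0 -bw; ring.
have awk k : (u * x) ^+ k * w = w.
  by elim: k => [|k IH]; rewrite ?expr0 ?mul1r // exprSr -mulrA aw.
by rewrite -(awk n) aN mul0r eqxx in w0.
Qed.

(** Take [x] nonzero with the largest annihilator. The last nonzero [x * y ^+ k] is killed by [y],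
    and by maximality its annihilator is that of [x]. *)
Lemma zero_divisors_annihilator :
  exists2 x, x != 0 & {in Z, forall y, x * y = 0}.
Proof.
pose ann x := [set z : R | x * z == 0].
have [x x0 max_x] :=
  @arg_maxnP R 1 (fun x => x != 0) (fun x => #|ann x|) (oner_neq0 R).
exists x => // y yZ; have [n yn] := zero_divisor_nilpotent yZ.
have ex_n : exists k, x * y ^+ k == 0 by exists n; rewrite yn mulr0.
have [[|k] xk0 min_k] := ex_minnP ex_n.
  by rewrite expr0 mulr1 (negPf x0) in xk0.
have xk : x * y ^+ k != 0.
  by apply/negP => /min_k; rewrite ltnn.
have : ann x = ann (x * y ^+ k).
  apply/eqP; rewrite eqEcard (max_x _ xk : (_ <= _)%N) andbT; apply/subsetP => z.
  by rewrite !inE mulrAC => /eqP->; rewrite mul0r.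
move/setP/(_ y); rewrite !inE -mulrA -exprSr xk0 => /eqP; exact.
Qed.

End Local.
End ZeroDivisors.

(** * Rings with a nontrivial idempotent *)

Section Peirce.
Variable R : finComNzRingType.
Implicit Types (x y e : R).
Local Notation Z := (zero_divisors R).
Local Notation Zs := (zero_divisors_star R).
Local Notation G := (zero_divisor_graph R).

Definition corner_set e := [set x : R | e * x == x].
(** The witness [w] ranges over all of [R]; for [e] idempotent, [e * w] is then an inverse inside
    the corner. *)
Definition corner_units e := [set x in corner_set e | [exists w, x * w == e]].
Definition corner_nonunits e := corner_set e :\: corner_units e.

Lemma corner_setP e x : reflect (e * x = x) (x \in corner_set e).
Proof. by rewrite inE; apply: eqP. Qed.

Lemma corner_set0 e : 0 \in corner_set e.
Proof. by rewrite inE mulr0. Qed.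

Lemma mul_corner_compl e x y : e * e = e ->
  x \in corner_set e -> y \in corner_set (1 - e) -> x * y = 0.
Proof.
move=> ee /corner_setP <- /corner_setP <-.
by rewrite mulrACA mulrBr ee mulr1 subrr mul0r.
Qed.

Lemma corner_compl_ann e y : e * y = 0 -> y \in corner_set (1 - e).
Proof. by move=> ey; rewrite inE mulrBl mul1r ey subr0. Qed.

Lemma ann_corner_compl e y : e * e = e -> y \in corner_set (1 - e) -> e * y = 0.
Proof. by move=> ee; apply: mul_corner_compl; rewrite // inE ee. Qed.

Lemma card_corner_set e :
  #|corner_set e| = (#|corner_units e| + #|corner_nonunits e|)%N.
Proof.
rewrite -(cardsID (corner_units e) (corner_set e)); congr (_ + _)%N.
by apply: eq_card => x; rewrite !inE andbA andbb.
Qed.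

Lemma corner_units_gt0 e : e * e = e -> (0 < #|corner_units e|)%N.
Proof.
move=> ee; apply/card_gt0P; exists e; rewrite !inE ee eqxx.
by apply/existsP; exists 1; rewrite mulr1.
Qed.

Lemma corner_nonunits_gt0 e : e != 0 -> (0 < #|corner_nonunits e|)%N.
Proof.
move=> e0; apply/card_gt0P; exists 0; rewrite !inE mulr0 eqxx andbT /=.
by apply/existsPn => w; rewrite mul0r eq_sym.
Qed.

Section SemiUnits.
Variable e : R.
Hypotheses (ee : e * e = e) (e0 : e != 0) (e1 : e != 1).
Let U := corner_units e.
Let N := corner_nonunits (1 - e).
(* The pairs (unit, nonunit) in R = eR x (1 - e)R. *)
Definition semi_units := [set x + y | x in U, y in N].

Let memU x : x \in U -> e * x = x.
Proof. by rewrite !inE => /andP[/eqP]. Qed.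

Let memN y : y \in N -> e * y = 0.
Proof. by case/setDP=> yc _; apply: ann_corner_compl. Qed.

Let proj x y : x \in U -> y \in N -> e * (x + y) = x.
Proof. by move=> xU yN; rewrite mulrDr memU // memN // addr0. Qed.

Let U_neq0 x : x \in U -> x != 0.
Proof.
case/setIdP=> _ /existsP[w /eqP xw].
by apply: contraNneq e0 => x0; rewrite -xw x0 mul0r.
Qed.

(** Addition is injective on pairs, because multiplying by [e] recovers the first component. *)
Lemma card_semi_units : #|semi_units| = (#|U| * #|N|)%N.
Proof.
rewrite /semi_units curry_imset2X card_in_imset ?cardsX //.
move=> [x y] [x' y'] /setXP[/= xU yN] /setXP[/= x'U y'N] /= eqs.
have eqx : x = x' by rewrite -(proj xU yN) eqs proj.
by move: eqs; rewrite eqx => /addrI ->.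
Qed.

(** The unit component makes the sum nonzero; an inverse of the sum would invert the nonunit
    component in the other corner. *)
Lemma semi_units_sub : semi_units \subset Zs.
Proof.
apply/subsetP => _ /imset2P[x y xU yN ->]; rewrite in_setD1; apply/andP; split.
  by apply: contraNneq (U_neq0 xU) => xy; rewrite -(proj xU yN) xy mulr0.
apply: contraT => /zero_divisorsPn[u xyu].
case/setDP: (yN) => yc /negP[]; rewrite inE yc; apply/existsP; exists ((1 - e) * u).
have /corner_setP fy := yc.
have fx : (1 - e) * x = 0.
  by rewrite mulrBl mul1r memU ?subrr.
apply/eqP; transitivity ((1 - e) * (x + y) * u).
  by rewrite mulrDr fx add0r fy mulrCA mulrA fy.
by rewrite -mulrA xyu mulr1.
Qed.

Lemma semi_units_mul_neq0 : {in semi_units &, forall x y, x * y != 0}.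
Proof.
move=> _ _ /imset2P[x y xU yN ->] /imset2P[x' y' x'U y'N ->].
apply: contraNneq (U_neq0 x'U) => xy.
case/setIdP: (xU) => _ /existsP[w /eqP xw].
(* The [e]-component of the product is [x * x'], and [w] cancels the corner unit [x]. *)
have -> : x' = w * e * e * ((x + y) * (x' + y')).
  rewrite -{1}(memU x'U) -{1}xw -{1}(proj xU yN) -{1}(proj x'U y'N); ring.
by rewrite xy mulr0.
Qed.

(** Cancelling the corner unit in the [e]-component of the product leaves [e * y = 0]. *)
Lemma semi_units_ann x y : x \in semi_units -> y \in Zs -> x * y = 0 ->
  y \in corner_set (1 - e) :\ 0.
Proof.
case/imset2P=> a b aU bN -> /setD1P[y0 _] aby; rewrite in_setD1 y0.
apply: corner_compl_ann; case/setIdP: (aU) => _ /existsP[w /eqP aw].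
have -> : e * y = e * w * ((a + b) * y).
  rewrite -{1}aw -{1}(proj aU bN); ring.
by rewrite aby mulr0.
Qed.

Lemma semi_units_hamiltonian : hamiltonian G ->
  (#|corner_set (1 - e)%R :\ 0%R| <= #|semi_units|)%N ->
  (independence_number G).*2 = #|Zs|.
Proof.
move=> hamG leTS.
apply: (zdg_hamiltonian_independence_number hamG semi_units_sub
          semi_units_mul_neq0 _ leTS semi_units_ann).
rewrite card_semi_units muln_gt0 corner_units_gt0 // corner_nonunits_gt0 //.
by rewrite subr_eq0 eq_sym.
Qed.

End SemiUnits.

(** The semi-units of [e] or those of [1 - e] are numerous enough for the equality case. *)
Lemma idempotent_hamiltonian e : e * e = e -> e != 0 -> e != 1 ->
  hamiltonian G -> (independence_number G).*2 = #|Zs|.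
Proof.
move=> ee e0 e1 hamG.
have ff := idempotent_compl ee.
have f0 : 1 - e != 0 by rewrite subr_eq0 eq_sym.
have f1 : 1 - e != 1 by rewrite -subr_eq0 addrC addKr oppr_eq0.
have Ke : 1 - (1 - e) = e by rewrite opprB addrC subrK.
have [] := leqP #|corner_set (1 - e) :\ 0| #|semi_units e|.
  exact: semi_units_hamiltonian.
have [] := leqP #|corner_set (1 - (1 - e)) :\ 0| #|semi_units (1 - e)|.
  by move=> le _; apply: semi_units_hamiltonian le.
rewrite !card_semi_units // Ke.
have := cardsD1 0 (corner_set e); rewrite corner_set0 card_corner_set.
have := cardsD1 0 (corner_set (1 - e)); rewrite corner_set0 card_corner_set.
have := corner_units_gt0 ee; have := corner_units_gt0 ff.
have := corner_nonunits_gt0 e0; have := corner_nonunits_gt0 f0.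
(* If both bounds failed, then b - 1 <= (b - 1) z < a - 1 <= (a - 1) w < b - 1, with a, z the unit
   and nonunit counts for [e] and b, w those for [1 - e]. *)
move: #|_ :\ _| #|_ :\ _| #|_| #|_| #|_| #|_|.
nia.
Qed.

Lemma neighbours_val (v : G) :
  val @: neighbours v = [set y in Zs | (y != val v) && (val v * y == 0)].
Proof.
apply/setP => y; apply/imsetP/setIdP => [[w wN ->]|[yZ /andP[nvy vy]]].
  split; first exact: zdg_vertexP.
  by move: wN; rewrite inE /= /zdg_adj eq_sym.
exists (exist (fun x => x \in Zs) y yZ : G) => //.
by rewrite inE /= /zdg_adj -val_eqE /= eq_sym nvy.
Qed.

Lemma regular_degree r x : regular G r -> x \in Zs ->
  #|[set y in Zs | (y != x) && (x * y == 0)]| = r.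
Proof.
move=> regG xZ; pose v : G := exist (fun x => x \in Zs) x xZ.
by rewrite -(regG v) -(card_imset _ val_inj) neighbours_val.
Qed.

Lemma idempotent_regular e r : e * e = e -> e != 0 -> e != 1 -> regular G r ->
  independence_number G = r.
Proof.
move=> ee e0 e1 regG.
have ff := idempotent_compl ee.
have f0 : 1 - e != 0 by rewrite subr_eq0 eq_sym.
have f1 : 1 - e != 1 by rewrite -subr_eq0 addrC addKr oppr_eq0.
have Ke : 1 - (1 - e) = e by rewrite opprB addrC subrK.
pose X := corner_set e :\ 0; pose Y := corner_set (1 - e) :\ 0.
pose nb x := [set y in Zs | (y != x) && (x * y == 0)].
have nbr x : x \in Zs -> #|nb x| = r := regular_degree regG.
have disj a x y : a * a = a -> x \in corner_set a :\ 0 ->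
    y \in corner_set (1 - a) :\ 0 -> [/\ y \in Zs, y != x & x * y = 0].
  move=> aa /setD1P[x0 xa] /setD1P[y0 ya]; have xy := mul_corner_compl aa xa ya.
  split=> //; first by apply: (zero_divisors_starI y0 x0); rewrite mulrC.
  apply: contraNneq x0 => eyx; rewrite eyx in ya.
  by rewrite -(corner_setP _ _ xa) (ann_corner_compl aa ya).
(* Stated for any nontrivial idempotent [a], to serve both [e] and [1 - e]. The right-hand side is
   the neighbourhood of [a] and is contained in that of [x]; equal degrees force equality. *)
have nbE a x : a * a = a -> a != 0 -> a != 1 -> x \in corner_set a :\ 0 ->
    nb x = corner_set (1 - a) :\ 0.
  move=> aa a0 a1 xX; have bb := idempotent_compl aa.
  have aX : a \in corner_set a :\ 0 by rewrite !inE a0 aa eqxx.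
  have bY : 1 - a \in corner_set (1 - a) :\ 0.
    by rewrite !inE bb eqxx subr_eq0 eq_sym a1.
  have inZ z : z \in corner_set a :\ 0 -> z \in Zs.
    move=> zX; have [_ _ zb] := disj _ _ _ aa zX bY.
    case/setD1P: zX => z0 _; apply: (zero_divisors_starI z0 _ zb).
    by rewrite subr_eq0 eq_sym.
  have sub z : z \in corner_set a :\ 0 -> corner_set (1 - a) :\ 0 \subset nb z.
    move=> zX; apply/subsetP => y /(disj _ _ _ aa zX)[yZ nyz zy].
    by rewrite inE yZ nyz zy eqxx.
  have nba : nb a = corner_set (1 - a) :\ 0.
    apply/eqP; rewrite eqEsubset sub // andbT; apply/subsetP => y.
    case/setIdP=> /setD1P[y0 _] /andP[_ /eqP ay].
    by rewrite in_setD1 y0 corner_compl_ann.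
  apply/esym/eqP; rewrite eqEcard sub // -nba.
  by rewrite /= !nbr ?inZ.
have nbX x : x \in X -> nb x = Y := nbE e x ee e0 e1.
have nbY y (yY : y \in Y) : nb y = X by rewrite (nbE _ _ ff f0 f1 yY) Ke.
have eX : e \in X by rewrite !inE e0 ee eqxx.
have fY : 1 - e \in Y by rewrite !inE f0 ff eqxx.
have inZX x : x \in X -> x \in Zs by rewrite -(nbY _ fY) => /setIdP[].
have inZY y : y \in Y -> y \in Zs by rewrite -(nbX _ eX) => /setIdP[].
have cardX : #|X| = r by rewrite -(nbY _ fY) nbr ?inZY.
have cardY : #|Y| = r by rewrite -(nbX _ eX) nbr ?inZX.
have coverXY : Zs \subset X :|: Y.
  apply/subsetP => v /setD1P[v0 /zero_divisorsP[w w0 vw]]; rewrite in_setU.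
  apply: contraT; rewrite negb_or => /andP[vX vY].
  (* If [a * w] were nonzero, [v] would be one of its neighbours and hence lie in the opposite
     corner. Applied to [e] and [1 - e], this makes both components of [w] vanish. *)
  have claim a : a * a = a -> v \notin corner_set a :\ 0 ->
      nb (a * w) = corner_set (1 - a) :\ 0 -> v \notin corner_set (1 - a) :\ 0 ->
    a * w = 0.
    move=> aa vA nbw vB; apply: contraNeq vB => aw0; rewrite -nbw.
    rewrite inE !inE v0 /= (_ : a * w * v = 0) ?eqxx ?andbT; last first.
      by rewrite -mulrA [w * v]mulrC vw mulr0.
    apply/andP; split; first by apply/existsP; exists w; rewrite w0 vw eqxx.
    apply: contraNneq vA => ->; rewrite !inE aw0 /=.
    by rewrite mulrA aa.
  have ew : e * w = 0.
    have [//|ew0] := eqVneq (e * w) 0.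
    by apply: claim => //; apply: nbX; rewrite !inE ew0 mulrA ee /=.
  have fw : (1 - e) * w = 0.
    have [//|fw0] := eqVneq ((1 - e) * w) 0.
    apply: claim => //; last by rewrite Ke.
    by rewrite Ke; apply: nbY; rewrite !inE fw0 mulrA ff /=.
  by rewrite -[w]mul1r -(subrK e 1) mulrDl ew fw addr0 eqxx in w0.
have lt2r : (#|Zs| <= r + r)%N.
  rewrite -{1}cardX -cardY (leq_trans (subset_leq_card coverXY)) //.
  exact: leq_card_setU.
apply/eqP; rewrite eqn_leq; apply/andP; split.
  apply/bigmax_leqP => A /independentP indA.
  have [->|/set0Pn[v vA]] := eqVneq A set0; first by rewrite cards0.
  (* The r neighbours of [v] lie outside [A], so |A| + r is at most the number of vertices, itself
     at most 2r. *)
  rewrite -(leq_add2r r) -{1}(regG v) -cardsUI.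
  rewrite (_ : A :&: _ = set0) ?cards0 ?addn0; last first.
    apply/setP => u; rewrite !inE; apply/negP => /andP[uA].
    exact/negP/(indA _ _ vA uA).
  by rewrite (leq_trans (max_card _)) // card_zdg.
(* The side [X] attains the bound: its vertices have all their neighbours in [Y], which is disjoint
   from [X]. *)
rewrite -{1}cardX -(@card_zdg_lift _ X); last by apply/subsetP.
apply/leq_independence_number/independentP => u v /[!inE] uX vX.
rewrite /= /zdg_adj; apply/negP => /andP[nuv uv].
have : val v \in nb (val u) by rewrite inE zdg_vertexP uv val_eqE eq_sym nuv.
rewrite nbX ?inE // => /andP[v0 /eqP fv].
have /andP[_ /eqP ev] := vX.
by rewrite -fv mulrBl ev mul1r subrr eqxx in v0.
Qed.

End Peirce.

(** * Regular and Hamiltonian graphs in the absence of nontrivial idempotents *)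

(** The common annihilator [a] of the zero divisors is adjacent to every other vertex, and by
    regularity every vertex has the degree of [a]. *)
Lemma local_regular (R : finComNzRingType) r :
    zero_divisors_star R != set0 -> (forall e : R, e * e = e -> e = 0 \/ e = 1) ->
    regular (zero_divisor_graph R) r ->
  independence_number (zero_divisor_graph R) = 1%N.
Proof.
move=> Z0 loc regG; apply: zdg_complete_independence_number => //.
have [a a0 annZ] := zero_divisors_annihilator loc.
have aZ : a \in zero_divisors_star R.
  case/set0Pn: Z0 => z /setD1P[z0 zZ].
  by apply: (zero_divisors_starI a0 z0); apply: annZ.
pose nb x : {set R} := [set y in zero_divisors_star R | (y != x) && (x * y == 0)].
have nba : nb a = zero_divisors_star R :\ a.
  apply/setP => y; rewrite [RHS]in_setD1.
  apply/setIdP/andP => [[yZ /andP[]]|[nya yZ]] //; split=> //.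
  by rewrite nya annZ ?eqxx //; case/setD1P: yZ.
move=> x y xZ yZ nxy.
have : nb x = zero_divisors_star R :\ x.
  apply/eqP; rewrite eqEcard; apply/andP; split.
    by apply/subsetP => z /setIdP[zZ /andP[nzx _]]; rewrite in_setD1 nzx.
  have /eqP := cardsD1 x (zero_divisors_star R).
  rewrite (cardsD1 a) aZ xZ eqn_add2l -nba => /eqP <-.
  by rewrite !(regular_degree regG).
by move/setP/(_ y); rewrite in_setD1 eq_sym nxy yZ inE => /andP[_ /andP[_ /eqP]].
Qed.

Lemma local_principal_hamiltonian (R : finComNzRingType) :
    (forall e : R, e * e = e -> e = 0 \/ e = 1) -> principal_ideal_ring R ->
    hamiltonian (zero_divisor_graph R) ->
  independence_number (zero_divisor_graph R) = 1%N.
Proof.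
move=> loc pirR hamG; pose Z := zero_divisors R.
have idZ : is_ideal Z.
  split; first by apply/zero_divisorsP; exists 1; rewrite ?oner_neq0 ?mul0r.
    exact: zero_divisorsD.
  exact: zero_divisorsMl.
have [t Zt] := pirR Z idZ; have [Z_0 ZD ZM] := idZ.
have tZ : t \in Z by rewrite Zt; apply/imsetP; exists 1; rewrite ?mul1r.
have Zs0 : zero_divisors_star R != set0.
  have [[|v c] [szc _ _ _]] := hamG; first by [].
  by apply/set0Pn; exists (val v); apply: zdg_vertexP.
have t0 : t != 0.
  apply: contraNneq Zs0 => t0; rewrite /zero_divisors_star -/Z Zt t0.
  apply/eqP/setP => x; rewrite !inE; apply/negP => /andP[/eqP x0 /imsetP[y _ xy]].
  by rewrite mulr0 in xy.
pose h (x : R) := t * x.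
have hB : zmod_morphism h by move=> x y; rewrite /h mulrBr.
have ZN x : x \in Z -> - x \in Z by move=> xZ; rewrite -mulN1r ZM.
(* With m = [Z] generated by [t], [Z2] is m^2 and [K] is the annihilator of [t]. *)
pose Z2 := h @: Z; pose K := [set x in Z | h x == 0].
have cardZ : #|Z| = (#|Z2| * #|K|)%N := card_additive_image hB ZD ZN.
have sZ2Z : Z2 \subset Z.
  by apply/subsetP => _ /imsetP[x xZ ->]; rewrite /h mulrC ZM.
have K0 : 0 \in K by rewrite inE Z_0 /h mulr0 eqxx.
have K2 : (1 < #|K|)%N.
  rewrite (cardsD1 0) K0 ltnS; apply/card_gt0P.
  have /zero_divisorsP[y y0 ty] := tZ; exists y.
  rewrite !inE y0 /h ty eqxx andbT; apply/existsP; exists t.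
  by rewrite t0 mulrC ty eqxx.
have Z20 : 0 \in Z2 by apply/imsetP; exists 0; rewrite // /h mulr0.
have le : (#|Z :\: Z2| <= #|K :\ 0%R|)%N.
  apply: (zdg_hamiltonian_leq_card hamG).
    apply/subsetP => x /setDP[xZ xZ2]; rewrite in_setD1 xZ andbT.
    by apply: contraNneq xZ2 => ->.
  move=> x y /setDP[xZ xZ2] /setD1P[y0 yZ] xy; rewrite in_setD1 y0 inE yZ /=.
  move: xZ xZ2 xy; rewrite Zt => /imsetP[u _ ->] utZ2 uty.
  (* Outside m^2 the cofactor [u] of [t] is a unit, so [u * t] and [t] have the same annihilator. *)
  have /zero_divisorsPn[w uw] : u \notin Z.
    by apply: contra utZ2 => uZ; apply/imsetP; exists u; rewrite // /h mulrC.
  have -> : h y = w * (u * t * y) by rewrite -[h y]mul1r -uw /h; ring.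
  by rewrite uty mulr0.
have Z21 : Z2 = [set 0].
  (* With k = |K| and z = |Z2|, the bound reads z k - z <= k - 1; as k > 1, this gives z <= 1. *)
  apply/eqP; rewrite eq_sym eqEcard sub1set Z20 cards1.
  have := cardsD Z Z2; rewrite (setIidPr sZ2Z) cardZ.
  have := cardsD1 0 K; rewrite K0.
  move: le K2; move: #|K| #|_ :\: _| #|K :\ 0| #|Z2| => k s k' z; nia.
apply: zdg_complete_independence_number => // x y /setD1P[_ xZ] /setD1P[_ yZ] _.
move: xZ; rewrite -/Z Zt => /imsetP[u _ ->].
have : h (u * y) \in Z2 by rewrite imset_f ?ZM.
rewrite Z21 => /set1P <-; rewrite /h; ring.
Qed.

(** * The case split on idempotents and the conclusion *)

Lemma idempotent_dichotomy (R : finComNzRingType) :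
  (exists e : R, [/\ e * e = e, e != 0 & e != 1]) \/
  (forall e : R, e * e = e -> e = 0 \/ e = 1).
Proof.
have [/existsP[e /and3P[/eqP ee e0 e1]]|/existsPn noE] :=
  boolP [exists e : R, [&& e * e == e, e != 0 & e != 1]].
  by left; exists e.
right=> e ee; have := noE e; rewrite ee eqxx /= negb_and !negbK.
by case/orP=> /eqP; [left|right].
Qed.

Lemma zero_divisors_star_neq0 (R : finComNzRingType) :
  ~ GRing.integral_domain_axiom R -> zero_divisors_star R != set0.
Proof.
move=> notID; apply: contra_notN notID => /eqP Z0 x y xy.
apply: contraT; rewrite negb_or => /andP[x0 y0].
by have := zero_divisors_starI x0 y0 xy; rewrite Z0 inE.
Qed.

Unset Implicit Arguments.

Theorem theorem6 (R : finComNzRingType)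
    (notID : ~ GRing.integral_domain_axiom R) :
  [/\ forall r : nat, regular (zero_divisor_graph R) r ->
        independence_number (zero_divisor_graph R) = 1%N \/
        independence_number (zero_divisor_graph R) = r,
      decomposable R -> hamiltonian (zero_divisor_graph R) ->
        (independence_number (zero_divisor_graph R))%:R
          = #|zero_divisors_star R|%:R / 2%:R :> rat
    & principal_ideal_ring R -> ~ decomposable R ->
      hamiltonian (zero_divisor_graph R) ->
        independence_number (zero_divisor_graph R) = 1%N].
Proof.
split=> [r regG|/idempotent_of_decomposable[e [ee e0 e1]] hamG|pirR indec hamG].
- have [[e [ee e0 e1]]|loc] := idempotent_dichotomy R.
    by right; apply: idempotent_regular ee e0 e1 regG.
  by left; apply: local_regular regG => //; apply: zero_divisors_star_neq0.
- by rewrite -(idempotent_hamiltonian ee e0 e1 hamG) -muln2 natrM mulfK.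
- have [[e [ee e0 e1]]|loc] := idempotent_dichotomy R.
    by case: indec; apply: decomposable_of_idempotent ee e0 e1.
  exact: local_principal_hamiltonian.
Qed.
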